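(* Let $A$ be a Green $\mathcal{D}$-biset functor over $k$. Then $\mathcal{P}_{A^{op}}\cong\mathcal{P}_A^{op}$ as ($k$-)linear categories.
   Context: All groups are finite; rings and algebras are associative and unital, with unit-preserving homomorphisms. Let $k$ be a commutative ring. $B(H,G)$ is the Burnside (Grothendieck) group of finite $(H,G)$-bisets (with $[X\sqcup Y]=[X]+[Y]$), and $B_k(H,G)=k\otimes B(H,G)$. The composition of a $(K,H)$-biset $Y$ and an $(H,G)$-biset $X$ is $Y\circ X=Y\times_H X$, the quotient of $Y\times X$ by $(yh,x)\sim(y,hx)$. The biset category $\mathcal{C}$ has all finite groups as objects, $Hom_{\mathcal{C}}(G,H)=B(H,G)$, composition $\circ$, and identity of $G$ the regular $(G,G)$-biset $G$. $\mathcal{D}\subseteq\mathcal{C}$ is a full subcategory whose objects are closed under subquotients and direct products; $k\mathcal{D}$ is its $k$-linearization. A $\mathcal{D}$-biset functor over $k$ is a $k$-linear functor $k\mathcal{D}\to {}_kMod$. For a homomorphism $\phi:G\to H$: $Ind(\phi)$ is $H$ as an $(H,G)$-biset ($h'\cdot h\cdot g=h'h\phi(g)$), and $Res(\phi)$ is $H$ as a $(G,H)$-biset ($g\cdot h\cdot h'=\phi(g)hh'$). $Inf_G^{G\times H}$ is $Res$ of the projection $G\times H\to G$. A Green $\mathcal{D}$-biset functor over $k$ is a $\mathcal{D}$-biset functor $A$ such that each $A(G)$ is a $k$-algebra and, for each homomorphism $\phi:G\to H$ of groups in $Ob(\mathcal{D})$: $A(Res(\phi))$ is a $k$-algebra homomorphism,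 and $a\,A(Ind(\phi))(b)=A(Ind(\phi))(A(Res(\phi))(a)b)$, $A(Ind(\phi))(b)\,a=A(Ind(\phi))(b\,A(Res(\phi))(a))$ for $a\in A(H)$, $b\in A(G)$. For $a\in A(G)$, $b\in A(H)$ put $a\times b=A(Inf_G^{G\times H})(a)\,A(Inf_H^{G\times H})(b)\in A(G\times H)$, and let $\epsilon_A=1\in A(1)$. The opposite $A^{op}$ is the functor $A$ with the opposite multiplication on each $A(G)$; it is again a Green $\mathcal{D}$-biset functor. The associated category $\mathcal{P}_A$ has objects $Ob(\mathcal{D})$, $Hom_{\mathcal{P}_A}(G,H)=A(H\times G)$, composition $\alpha\circ\beta=A(K\times\overleftarrow{H}\times G)(\alpha\times\beta)$ for $\alpha\in A(K\times H)$, $\beta\in A(H\times G)$, and identity $A(\overrightarrow{G})(\epsilon_A)$ of $G$. Here $\overrightarrow{G}$ is $G$ as a $(G\times G,1)$-biset via $(g_1,g_2)\cdot g=g_1gg_2^{-1}$, and $K\times\overleftarrow{H}\times G$ is the $(K\times G,K\times H\times H\times G)$-biset $K\times H\times G$ with $(k',g')\cdot(k,h,g)\cdot(k_1,h_1,h_2,g_1)=(k'kk_1,h_1^{-1}hh_2,g'gg_1)$. $\mathcal{P}_A^{op}$ denotes the opposite category of $\mathcal{P}_A$. *)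

(* Defs.v *)
From HB Require Import structures.
From mathcomp Require Import all_boot all_order all_fingroup all_algebra.
From mathcomp Require Import boolp.

Set Implicit Arguments.
Unset Strict Implicit.
Unset Printing Implicit Defensive.

Import GRing.Theory.

Local Open Scope quotient_scope.

Section Presentation.
Local Open Scope ring_scope.
Variables (k : comPzRingType) (T : Type).
(* [(a1, x1); ...; (an, xn)] stands for the formal sum a1 x1 + ... + an xn,
   and R s t for the relation s = t imposed on the generators. *)
Variable R : seq (k * T) -> seq (k * T) -> Prop.

Definition fscale (a : k) (s : seq (k * T)) := [seq (a * p.1, p.2) | p <- s].

Inductive pres_eq : seq (k * T) -> seq (k * T) -> Prop :=
| pe_refl s : pres_eq s s
| pe_sym s t : pres_eq s t -> pres_eq t s
| pe_trans s t u : pres_eq s t -> pres_eq t u -> pres_eq s u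
| pe_cat s s' t t' : pres_eq s s' -> pres_eq t t' -> pres_eq (s ++ t) (s' ++ t')
| pe_swap s t : pres_eq (s ++ t) (t ++ s)
| pe_add a b x : pres_eq [:: (a, x); (b, x)] [:: (a + b, x)]
| pe_zero x : pres_eq [:: (0, x)] [::]
| pe_rel a s t : R s t -> pres_eq (fscale a s) (fscale a t).

Definition pres_eqb (s t : {classic seq (k * T)}) : bool := `[< pres_eq s t >].

Lemma pres_eqb_equiv : equiv_class_of pres_eqb.
Proof.
split=> [s|s t|t s u].
- by apply/asboolP; apply: pe_refl.
- by apply/asboolP/asboolP; apply: pe_sym.
- by move=> /asboolP st /asboolP tu; apply/asboolP; apply: pe_trans st tu.
Qed.

Canonical pres_equiv := EquivRelPack pres_eqb_equiv.

Definition pmod := {eq_quot pres_equiv}.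
HB.instance Definition _ := Choice.on pmod.

Definition pcls (s : seq (k * T)) : pmod := \pi_pmod (s : {classic seq (k * T)}).
Definition prep (u : pmod) : seq (k * T) := generic_quotient.repr u.

Lemma prepK u : pcls (prep u) = u.
Proof. exact: reprK. Qed.

Lemma pclsP s t : pcls s = pcls t <-> pres_eq s t.
Proof.
split=> [/eqquotP /asboolP //|st]; apply/eqquotP.
exact/asboolP.
Qed.

Lemma prep_cls s : pres_eq (prep (pcls s)) s.
Proof. by apply/pclsP; rewrite prepK. Qed.

Lemma fscale_eq a s t : pres_eq s t -> pres_eq (fscale a s) (fscale a t).
Proof.
elim=> {s t} /=.
- by move=> s; apply: pe_refl.
- by move=> s t _; apply: pe_sym.
- by move=> s t u _ st _; apply: pe_trans st.
- by move=> s s' t t' _ ss' _ tt'; rewrite /fscale !map_cat; apply: pe_cat.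
- by move=> s t; rewrite /fscale !map_cat; apply: pe_swap.
- by move=> b c x; rewrite mulrDr; apply: pe_add.
- by move=> x; rewrite mulr0; apply: pe_zero.
- move=> b s t st; have sA r : fscale a (fscale b r) = fscale (a * b) r.
    by rewrite /fscale -map_comp; apply: eq_map => p /=; rewrite mulrA.
  by rewrite !sA; apply: pe_rel.
Qed.

Lemma fscale0 s : pres_eq (fscale 0 s) [::].
Proof.
elim: s => [|p s IHs]; first exact: pe_refl.
rewrite /= mul0r -[[::]]/([::] ++ [::]) -cat1s.
by apply: pe_cat IHs; apply: pe_zero.
Qed.

Lemma fscaleD a b s : pres_eq (fscale (a + b) s) (fscale a s ++ fscale b s).
Proof.
elim: s => [|p s IHs]; first exact: pe_refl.
rewrite /= mulrDl -cat1s.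
apply: (pe_trans (t := [:: (a * p.1, p.2); (b * p.1, p.2)] ++
                       (fscale a s ++ fscale b s))).
  by apply: pe_cat IHs; apply: pe_sym; apply: pe_add.
apply: (pe_cat (s := [:: _]) (s' := [:: _])); first exact: pe_refl.
rewrite -/(fscale _ _) -[_ :: fscale b s]cat1s catA.
apply: (pe_cat (s := [:: _] ++ fscale a s)); last exact: pe_refl.
exact: pe_swap.
Qed.

Lemma fscale1 s : fscale 1 s = s.
Proof. by rewrite -[RHS]map_id; apply: eq_map => -[a x] /=; rewrite mul1r. Qed.

Definition padd (u v : pmod) : pmod := pcls (prep u ++ prep v).
Definition pscale (a : k) (u : pmod) : pmod := pcls (fscale a (prep u)).
Definition pzero : pmod := pcls [::].
Definition popp (u : pmod) : pmod := pscale (-1) u.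

Lemma padd_cls s t : padd (pcls s) (pcls t) = pcls (s ++ t).
Proof. by apply/pclsP; apply: pe_cat; apply: prep_cls. Qed.

Lemma pscale_cls a s : pscale a (pcls s) = pcls (fscale a s).
Proof. by apply/pclsP; apply: fscale_eq; apply: prep_cls. Qed.

Lemma paddA : associative padd.
Proof.
move=> u v w; rewrite -[u]prepK -[v]prepK -[w]prepK !padd_cls.
by rewrite catA.
Qed.

Lemma paddC : commutative padd.
Proof.
move=> u v; rewrite -[u]prepK -[v]prepK !padd_cls.
by apply/pclsP; apply: pe_swap.
Qed.

Lemma padd0 : left_id pzero padd.
Proof. by move=> u; rewrite -[u]prepK padd_cls. Qed.

Lemma pscaleDl v : {morph pscale^~ v : a b / a + b >-> padd a b}.
Proof.
move=> a b; rewrite -[v]prepK !pscale_cls padd_cls.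
by apply/pclsP; apply: fscaleD.
Qed.

Lemma pscale1 : left_id 1 pscale.
Proof. by move=> u; rewrite -[u]prepK pscale_cls fscale1. Qed.

Lemma paddN : left_inverse pzero popp padd.
Proof.
move=> u; rewrite /popp -{2}[u]pscale1 -pscaleDl addNr.
by rewrite -[u]prepK pscale_cls; apply/pclsP; apply: fscale0.
Qed.

HB.instance Definition _ := GRing.isZmodule.Build pmod paddA paddC padd0 paddN.

Lemma paddE (u v : pmod) : u + v = padd u v. Proof. by []. Qed.

Lemma pscaleA a b v : pscale a (pscale b v) = pscale (a * b) v.
Proof.
rewrite -[v]prepK !pscale_cls; congr pcls.
by rewrite /fscale -map_comp; apply: eq_map => p /=; rewrite mulrA.
Qed.

Lemma pscaleDr : right_distributive pscale +%R.
Proof.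
move=> a u v; rewrite -[u]prepK -[v]prepK !paddE padd_cls !pscale_cls padd_cls.
by rewrite /fscale map_cat.
Qed.

HB.instance Definition _ :=
  GRing.Zmodule_isLmodule.Build k pmod pscaleA pscale1 pscaleDr pscaleDl.

Lemma pscaleE a (u : pmod) : a *: u = pscale a u. Proof. by []. Qed.

Definition pgen (x : T) : pmod := pcls [:: (1, x)].

Section Lift.
Variables (V : lmodType k) (f : T -> V).

Definition fsum (s : seq (k * T)) : V := \sum_(p <- s) p.1 *: f p.2.

(* The linear extension of f; meaningful when f satisfies the relations R. *)
Definition plift (u : pmod) : V := fsum (prep u).

Hypothesis fR : forall s t, R s t -> fsum s = fsum t.

Lemma fsum_scale a s : fsum (fscale a s) = a *: fsum s.
Proof.
rewrite /fsum scaler_sumr big_map.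
by apply: eq_bigr => p _ /=; rewrite scalerA.
Qed.

Lemma fsum_eq s t : pres_eq s t -> fsum s = fsum t.
Proof.
elim=> {s t} //.
- by move=> s t u _ -> _ ->.
- by move=> s s' t t' _; rewrite /fsum !big_cat /= => -> _ ->.
- by move=> s t; rewrite /fsum !big_cat /= addrC.
- by move=> a b x; rewrite /fsum !big_cons !big_nil /= !addr0 scalerDl.
- by move=> x; rewrite /fsum !big_cons !big_nil /= scale0r addr0.
- by move=> a s t /fR; rewrite !fsum_scale => ->.
Qed.

Lemma plift_cls s : plift (pcls s) = fsum s.
Proof. by apply: fsum_eq; apply: prep_cls. Qed.

Lemma plift_gen x : plift (pgen x) = f x.
Proof. by rewrite plift_cls /fsum big_seq1 scale1r. Qed.

Lemma plift_linear : linear plift.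
Proof.
move=> a u v; rewrite -[u]prepK -[v]prepK.
rewrite pscaleE pscale_cls paddE padd_cls !plift_cls.
by rewrite {1}/fsum big_cat /= -/(fsum _) -/(fsum _) fsum_scale.
Qed.

End Lift.

Lemma pmod_ind (P : pmod -> Prop) :
  P 0 -> (forall a x u, P u -> P (a *: pgen x + u)) -> forall u, P u.
Proof.
move=> P0 PS u; rewrite -[u]prepK; elim: (prep u) => [//|[a x] s IHs].
have -> : pcls ((a, x) :: s) = a *: pgen x + pcls s.
  by rewrite pscaleE pscale_cls paddE padd_cls /= mulr1.
exact: PS.
Qed.

Lemma linear_0 (V W : lmodType k) (f : V -> W) : linear f -> f 0 = 0.
Proof. by move=> lf; have := lf (-1) 0 0; rewrite scaler0 addr0 scaleN1r addNr. Qed.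

Lemma pmod_ext (V : lmodType k) (f g : pmod -> V) :
  linear f -> linear g -> (forall x, f (pgen x) = g (pgen x)) -> f =1 g.
Proof.
move=> lf lg fg; elim/pmod_ind => [|a x u IHu]; first by rewrite !linear_0.
by rewrite lf lg fg IHu.
Qed.

Lemma pgen_rel s t : R s t -> fsum pgen s = fsum pgen t.
Proof.
have fsumE r : fsum pgen r = pcls r.
  elim: r => [|[a x] r IHr]; first by rewrite /fsum big_nil.
  rewrite /fsum big_cons -/(fsum _ _) IHr.
  by rewrite pscaleE pscale_cls paddE padd_cls /= mulr1.
move=> Rst; rewrite !fsumE; apply/pclsP.
by rewrite -[s]fscale1 -[t]fscale1; apply: pe_rel.
Qed.

End Presentation.

Lemma plift_ext (k : comPzRingType) T (R : seq (k * T) -> seq (k * T) -> Prop)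
  (V : lmodType k) (f g : T -> V) : f =1 g -> plift (R := R) f =1 plift g.
Proof. by move=> fg u; apply: eq_bigr => p _; rewrite fg. Qed.

Section LinearCategories.
Local Open Scope ring_scope.

Record lincat (k : comPzRingType) := LinCat {
  Ob : Type;
  homc : Ob -> Ob -> lmodType k;
  idc : forall x, homc x x;
  compc : forall x y z, homc y z -> homc x y -> homc x z;
  compc_linear_l : forall x y z (f : homc x y), linear (fun g : homc y z => compc g f);
  compc_linear_r : forall x y z (g : homc y z), linear (fun f : homc x y => compc g f);
  compc1l : forall x y (f : homc x y), compc (idc y) f = f;
  compc1r : forall x y (f : homc x y), compc f (idc x) = f;
  compcA : forall x y z w (h : homc z w) (g : homc y z) (f : homc x y),
    compc h (compc g f) = compc (compc h g) f
}.

Variable k : comPzRingType.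

Record linfunctor (C C' : lincat k) := LinFun {
  fob : Ob C -> Ob C';
  fmor : forall x y, homc x y -> homc (fob x) (fob y);
  fmor_linear : forall x y, linear (@fmor x y);
  fmor_id : forall x, fmor (idc x) = idc (fob x);
  fmor_comp : forall x y z (g : homc y z) (f : homc x y),
    fmor (compc g f) = compc (fmor g) (fmor f)
}.

Definition linfun_id (C : lincat k) : linfunctor C C.
Proof. by apply: (@LinFun C C id (fun _ _ => id)). Defined.

Definition linfun_comp (C C' C'' : lincat k) (F' : linfunctor C' C'') (F : linfunctor C C') :
  linfunctor C C''.
Proof.
apply: (@LinFun C C'' (fun x => fob F' (fob F x)) (fun _ _ f => fmor F' (fmor F f))).
- by move=> x y a u v; rewrite !fmor_linear.
- by move=> x; rewrite !fmor_id.
- by move=> x y z g f; rewrite !fmor_comp.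
Defined.

(* Equality of functors is Leibniz equality, on objects and on morphisms. *)
Definition lincat_iso (C C' : lincat k) : Prop :=
  exists (F : linfunctor C C') (F' : linfunctor C' C),
    linfun_comp F' F = linfun_id C /\ linfun_comp F F' = linfun_id C'.

Definition opcat (C : lincat k) : lincat k.
Proof.
apply: (@LinCat k (Ob C) (fun x y => homc y x) (@idc k C)
          (fun x y z g f => compc f g)).
- by move=> x y z f; apply: compc_linear_r.
- by move=> x y z g; apply: compc_linear_l.
- by move=> x y f; rewrite compc1r.
- by move=> x y f; rewrite compc1l.
- by move=> x y z w h g f; rewrite compcA.
Defined.

Definition fullsub (C : lincat k) (P : Ob C -> Prop) : lincat k.
Proof.
apply: (@LinCat k {x : Ob C | P x} (fun x y => homc (sval x) (sval y))
          (fun x => idc (sval x)) (fun x y z g f => compc g f)).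
- by move=> x y z f; apply: compc_linear_l.
- by move=> x y z g; apply: compc_linear_r.
- by move=> x y f; rewrite compc1l.
- by move=> x y f; rewrite compc1r.
- by move=> x y z w h g f; rewrite compcA.
Defined.

Record modfun (C : lincat k) := ModFun {
  mob :> Ob C -> lmodType k;
  mmor : forall x y, homc x y -> mob x -> mob y;
  mmor_linear : forall x y (f : homc x y), linear (mmor f);
  mmor_linear_l : forall x y (u : mob x), linear (fun f : homc x y => mmor f u);
  mmor_id : forall x (u : mob x), mmor (idc x) u = u;
  mmor_comp : forall x y z (g : homc y z) (f : homc x y) (u : mob x),
    mmor (compc g f) u = mmor g (mmor f u)
}.

(* The tensor product of k and the additive group M, over the integers;
   the generator m stands for 1 (x) m. *)
Inductive tens_rel (M : zmodType) : seq (k * M) -> seq (k * M) -> Prop :=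
| TensRel m n : tens_rel [:: (1, m + n)] [:: (1, m); (1, n)].

Definition tens (M : zmodType) : lmodType k := pmod (@tens_rel M).
Definition tgen (M : zmodType) (m : M) : tens M := pgen (@tens_rel M) m.

Lemma tgenD (M : zmodType) (m n : M) : tgen (m + n) = tgen m + tgen n.
Proof.
have := pgen_rel (TensRel m n).
by rewrite /fsum !big_cons !big_nil !addr0 !scale1r.
Qed.

Lemma tlift_rel (M : zmodType) (V : lmodType k) (f : M -> V) :
  {morph f : m n / m + n} -> forall s t, tens_rel s t -> fsum f s = fsum f t.
Proof.
move=> fD _ _ [m n].
by rewrite /fsum !big_cons !big_nil !addr0 !scale1r /= fD.
Qed.

End LinearCategories.

Lemma plift_linear_l (k : comPzRingType) T (R : seq (k * T) -> seq (k * T) -> Prop)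
    (V : lmodType k) (W : lmodType k) (f : W -> T -> V) (u : pmod R) :
  (forall x, linear (f^~ x)) -> linear (fun w => plift (f w) u).
Proof.
move=> lf a v w; rewrite /plift /fsum scaler_sumr -big_split /=.
apply: eq_bigr => p _; rewrite lf scalerDr !scalerA; congr (_ *: _ + _)%R.
by rewrite mulrC.
Qed.

Section Bisets.
Local Open Scope group_scope.

Record biset_on (H G : finGroupType) (X : Type) := BisetOn {
  lact : H -> X -> X;
  ract : X -> G -> X;
  lact1 : forall x, lact 1 x = x;
  lactM : forall h h' x, lact (h * h') x = lact h (lact h' x);
  ract1 : forall x, ract x 1 = x;
  ractM : forall x g g', ract x (g * g') = ract (ract x g) g';
  lractA : forall h x g, lact h (ract x g) = ract (lact h x) g
}.

Record biset (H G : finGroupType) := Biset {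
  bset :> finType;
  bstr :> biset_on H G bset
}.

Local Notation "h *< x" := (lact (bstr _) h x) (at level 40, left associativity).
Local Notation "x >* g" := (ract (bstr _) x g) (at level 40, left associativity).

Definition biso (H G : finGroupType) (X Y : biset H G) : Prop :=
  exists f : X -> Y, [/\ bijective f, forall h x, f (h *< x) = h *< f x
                       & forall x g, f (x >* g) = f x >* g].

Lemma biso_refl H G (X : biset H G) : biso X X.
Proof. by exists id; split=> //; exists id. Qed.

Lemma biso_sym H G (X Y : biset H G) : biso X Y -> biso Y X.
Proof.
case=> f [[g fK gK] fl fr]; exists g; split; first by exists f.
  by move=> h y; apply: (can_inj fK); rewrite fl !gK.
by move=> y x; apply: (can_inj fK); rewrite fr !gK.
Qed.

Lemma biso_trans H G (X Y Z : biset H G) : biso X Y -> biso Y Z -> biso X Z.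
Proof.
case=> f [fB fl fr] [g [gB gl gr]]; exists (g \o f); split.
- exact: bij_comp.
- by move=> h x /=; rewrite fl gl.
- by move=> x h /=; rewrite fr gr.
Qed.

Definition bunion (H G : finGroupType) (X Y : biset H G) : biset H G.
Proof.
apply: (@Biset H G (X + Y)%type (@BisetOn H G _
  (fun h u => match u with inl x => inl (h *< x) | inr y => inr (h *< y) end)
  (fun u g => match u with inl x => inl (x >* g) | inr y => inr (y >* g) end)
  _ _ _ _ _)).
- by case=> x; rewrite lact1.
- by move=> h h' [] x; rewrite lactM.
- by case=> x; rewrite ract1.
- by move=> [] x g g'; rewrite ractM.
- by move=> h [] x g; rewrite lractA.
Defined.

Definition breg (G : finGroupType) : biset G G.
Proof.
apply: (@Biset G G G (@BisetOn G G G (fun h x => h * x) (fun x g => x * g) _ _ _ _ _)).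
- exact: mul1g.
- by move=> h h' x; rewrite mulgA.
- exact: mulg1.
- by move=> x g g'; rewrite mulgA.
- by move=> h x g; rewrite mulgA.
Defined.

Section Composition.
Variables (K H G : finGroupType) (Y : biset K H) (X : biset H G).

(* (y h, x) ~ (y, h x) *)
Definition bcomp_rel (u v : Y * X) : bool :=
  [exists h : H, (v.1 == u.1 >* h) && (u.2 == h *< v.2)].

Lemma bcomp_relP y x y' x' :
  reflect (exists h, y' = y >* h /\ x = h *< x') (bcomp_rel (y, x) (y', x')).
Proof.
apply: (iffP existsP) => -[h].
  by case/andP=> /eqP ? /eqP ?; exists h.
by case=> -> ->; exists h; rewrite !eqxx.
Qed.

Lemma bcomp_rel_equiv : equiv_class_of bcomp_rel.
Proof.
split=> [[y x]|[y x] [y' x']|[y x] [y' x'] [y'' x'']].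
- by apply/bcomp_relP; exists 1; rewrite lact1 ract1.
- apply/bcomp_relP/bcomp_relP => -[h [-> ->]]; exists h^-1;
  by rewrite -ractM -lactM ?mulgV ?mulVg ract1 lact1.
- move=> /bcomp_relP[h [-> ->]] /bcomp_relP[h' [-> ->]].
  by apply/bcomp_relP; exists (h * h'); rewrite ractM lactM.
Qed.

Canonical bcomp_equiv := EquivRelPack bcomp_rel_equiv.

Definition bcomp_set := {eq_quot bcomp_equiv}.
HB.instance Definition _ := [Finite of bcomp_set by <:%/].

Definition bpair (y : Y) (x : X) : bcomp_set := \pi_bcomp_set (y, x).

Lemma bpairP y x y' x' :
  bpair y x = bpair y' x' <-> exists h, y' = y >* h /\ x = h *< x'.
Proof.
split=> [/eqquotP /bcomp_relP //|/bcomp_relP yx].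
exact/eqquotP.
Qed.

Definition bfst (u : bcomp_set) : Y := (generic_quotient.repr u).1.
Definition bsnd (u : bcomp_set) : X := (generic_quotient.repr u).2.

Lemma bpairK u : bpair (bfst u) (bsnd u) = u.
Proof. by rewrite /bpair -surjective_pairing; apply: reprK. Qed.

Definition bcomp_l (k : K) (u : bcomp_set) := bpair (k *< bfst u) (bsnd u).
Definition bcomp_r (u : bcomp_set) (g : G) := bpair (bfst u) (bsnd u >* g).

Lemma bcomp_lE k y x : bcomp_l k (bpair y x) = bpair (k *< y) x.
Proof.
have /bpairP[h [E1 E2]] := bpairK (bpair y x).
by apply/bpairP; exists h; rewrite -lractA -E1.
Qed.

Lemma bcomp_rE y x g : bcomp_r (bpair y x) g = bpair y (x >* g).
Proof.
have /bpairP[h [E1 E2]] := bpairK (bpair y x).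
by apply/bpairP; exists h; rewrite lractA -E2.
Qed.

Definition bcomp : biset K G.
Proof.
apply: (@Biset K G bcomp_set (@BisetOn K G bcomp_set bcomp_l bcomp_r _ _ _ _ _)).
- by move=> u; rewrite -[u]bpairK bcomp_lE lact1.
- by move=> k k' u; rewrite -[u]bpairK !bcomp_lE lactM.
- by move=> u; rewrite -[u]bpairK bcomp_rE ract1.
- by move=> u g g'; rewrite -[u]bpairK !bcomp_rE ractM.
- by move=> k u g; rewrite -[u]bpairK bcomp_rE !bcomp_lE bcomp_rE.
Defined.

(* A balanced map Y x X -> Z which exhibits Z as the composition. *)
Lemma bcomp_biso (Z : biset K G) (m : Y -> X -> Z) :
    (forall y h x, m (y >* h) x = m y (h *< x)) ->
    (forall k y x, m (k *< y) x = k *< m y x) ->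
    (forall y x g, m y (x >* g) = m y x >* g) ->
    (forall z, exists y x, m y x = z) ->
    (forall y x y' x', m y x = m y' x' -> exists h, y' = y >* h /\ x = h *< x') ->
  biso bcomp Z.
Proof.
move=> mb ml mr ms mi; pose f (u : bcomp) : Z := m (bfst u) (bsnd u).
have fE y x : f (bpair y x) = m y x.
  rewrite /f; have /bpairP[h [E1 E2]] := bpairK (bpair y x).
  by rewrite E2 -mb -E1.
have f_inj : injective f.
  move=> u v; rewrite -[u]bpairK -[v]bpairK !fE => /mi uv; exact/bpairP.
exists f; split.
- have fS z : exists u, f u = z.
    by have [y [x <-]] := ms z; exists (bpair y x).
  pose g z := sval (cid (fS z)).
  have gK z : f (g z) = z by rewrite /g; case: cid.
  by exists g => // u; apply: f_inj; rewrite gK.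
- by move=> k u; rewrite -[u]bpairK /= bcomp_lE !fE ml.
- by move=> u g; rewrite -[u]bpairK /= bcomp_rE !fE mr.
Qed.

End Composition.

Lemma bpair_bal K H G (Y : biset K H) (X : biset H G) y h x :
  bpair (Y := Y) (X := X) (y >* h) x = bpair y (h *< x).
Proof.
apply/bpairP; exists h^-1.
by rewrite -ractM -lactM mulgV mulVg ract1 lact1.
Qed.

Lemma bcomp_congr K H G (Y Y' : biset K H) (X X' : biset H G) :
  biso Y Y' -> biso X X' -> biso (bcomp Y X) (bcomp Y' X').
Proof.
case=> f [[f' fK f'K] fl fr] [g [[g' gK g'K] gl gr]].
apply: (@bcomp_biso _ _ _ Y X (bcomp Y' X') (fun y x => bpair (f y) (g x))).
- by move=> y h x; rewrite fr gl bpair_bal.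
- by move=> k y x; rewrite fl /= bcomp_lE.
- by move=> y x h; rewrite gr /= bcomp_rE.
- by move=> z; exists (f' (bfst z)), (g' (bsnd z)); rewrite f'K g'K bpairK.
- move=> y x y' x' /bpairP[h [E1 E2]]; exists h; split.
    by apply: (can_inj fK); rewrite fr.
  by apply: (can_inj gK); rewrite gl.
Qed.

Lemma bcompA L K H G (Z : biset L K) (Y : biset K H) (X : biset H G) :
  biso (bcomp Z (bcomp Y X)) (bcomp (bcomp Z Y) X).
Proof.
pose m (z : Z) (u : bcomp Y X) : bcomp (bcomp Z Y) X :=
  @bpair _ _ _ (bcomp Z Y) X (bpair z (bfst u)) (bsnd u).
have mE z y x : m z (bpair y x) = @bpair _ _ _ (bcomp Z Y) X (bpair z y) x.
  rewrite /m; have /bpairP[h [E1 E2]] := bpairK (bpair y x).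
  rewrite E2 -bpair_bal {2}E1; congr bpair.
  by rewrite /= bcomp_rE.
apply: (@bcomp_biso _ _ _ Z (bcomp Y X) _ m).
- by move=> z k u; rewrite -[u]bpairK /= bcomp_lE !mE bpair_bal.
- by move=> l z u; rewrite -[u]bpairK !mE /= bcomp_lE /= bcomp_lE.
- by move=> z u g; rewrite -[u]bpairK /= bcomp_rE !mE bcomp_rE.
- move=> w; exists (bfst (bfst w)), (bpair (bsnd (bfst w)) (bsnd w)).
  by rewrite mE !bpairK.
- move=> z u z' u'; rewrite -[u]bpairK -[u']bpairK !mE.
  move=> /bpairP[h [/= E1 E2]]; move: E1; rewrite bcomp_rE => /esym/bpairP[k [E1 E3]].
  exists k; split=> //; rewrite /= bcomp_lE.
  by apply/bpairP; exists h; rewrite E2 -E3.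
Qed.

Lemma bcomp1l H G (X : biset H G) : biso (bcomp (breg H) X) X.
Proof.
apply: (@bcomp_biso _ _ _ (breg H) X X (fun h x => h *< x)).
- by move=> y h x; rewrite /= lactM.
- by move=> k y x; rewrite /= lactM.
- by move=> y x g; rewrite lractA.
- by move=> z; exists 1, z; rewrite lact1.
- move=> y x y' x' E; exists (y^-1 * y'); rewrite /= mulKVg.
  by rewrite lactM -E -lactM mulVg lact1.
Qed.

Lemma bcomp1r H G (X : biset H G) : biso (bcomp X (breg G)) X.
Proof.
apply: (@bcomp_biso _ _ _ X (breg G) X (fun x g => x >* g)).
- by move=> y h x; rewrite /= ractM.
- by move=> k y x; rewrite lractA.
- by move=> y x g; rewrite /= ractM.
- by move=> z; exists z, 1; rewrite ract1.
- move=> y x y' x' E; exists (x * x'^-1); rewrite /= mulgKV.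
  by rewrite ractM E -ractM mulgV ract1.
Qed.

Lemma bcomp_unionr K H G (Y : biset K H) (X X' : biset H G) :
  biso (bcomp Y (bunion X X')) (bunion (bcomp Y X) (bcomp Y X')).
Proof.
pose m (y : Y) (u : bunion X X') : bunion (bcomp Y X) (bcomp Y X') :=
  match u with inl x => inl (bpair y x) | inr x => inr (bpair y x) end.
apply: (@bcomp_biso _ _ _ Y (bunion X X') _ m).
- by move=> y h [] x; rewrite /= bpair_bal.
- by move=> k y [] x; rewrite /= bcomp_lE.
- by move=> y [] x g; rewrite /= bcomp_rE.
- case=> u; first by exists (bfst u), (inl (bsnd u)); rewrite /= bpairK.
  by exists (bfst u), (inr (bsnd u)); rewrite /= bpairK.
- by move=> y [] x y' [] x' //= [] /bpairP[h [-> ->]]; exists h.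
Qed.

Lemma bcomp_unionl K H G (Y Y' : biset K H) (X : biset H G) :
  biso (bcomp (bunion Y Y') X) (bunion (bcomp Y X) (bcomp Y' X)).
Proof.
pose m (u : bunion Y Y') (x : X) : bunion (bcomp Y X) (bcomp Y' X) :=
  match u with inl y => inl (bpair y x) | inr y => inr (bpair y x) end.
apply: (@bcomp_biso _ _ _ (bunion Y Y') X _ m).
- by move=> [] y h x; rewrite /= bpair_bal.
- by move=> k [] y x; rewrite /= bcomp_lE.
- by move=> [] y x g; rewrite /= bcomp_rE.
- case=> u; first by exists (inl (bfst u)), (bsnd u); rewrite /= bpairK.
  by exists (inr (bfst u)), (bsnd u); rewrite /= bpairK.
- by move=> [] y x [] y' x' //= [] /bpairP[h [-> ->]]; exists h.
Qed.

Lemma bunion_congr H G (X X' Y Y' : biset H G) :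
  biso X X' -> biso Y Y' -> biso (bunion X Y) (bunion X' Y').
Proof.
case=> f [[f' fK f'K] fl fr] [g [[g' gK g'K] gl gr]].
exists (fun u : bunion X Y =>
  match u with inl x => inl (f x) | inr y => inr (g y) end : bunion X' Y').
split.
- exists (fun u => match u with inl x => inl (f' x) | inr y => inr (g' y) end).
    by case=> x; rewrite ?fK ?gK.
  by case=> x; rewrite ?f'K ?g'K.
- by move=> h [] x /=; rewrite ?fl ?gl.
- by move=> [] x h /=; rewrite ?fr ?gr.
Qed.

(* The finite bisets form a proper class: the generators of the Burnside group
   are those with underlying set 'I_n, which represent all isomorphism
   classes. *)
Record skel (H G : finGroupType) := Skel {
  sdim : nat;
  sstr : biset_on H G 'I_sdim
}.

Definition biset_of_skel H G (s : skel H G) : biset H G := Biset (sstr s).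
Coercion biset_of_skel : skel >-> biset.

Definition skel_of H G (X : biset H G) : skel H G.
Proof.
apply: (@Skel H G #|X| (@BisetOn H G 'I_#|X|
  (fun h i => enum_rank (h *< enum_val i)) (fun i g => enum_rank (enum_val i >* g))
  _ _ _ _ _)).
- by move=> i; rewrite lact1 enum_valK.
- by move=> h h' i; rewrite lactM enum_rankK.
- by move=> i; rewrite ract1 enum_valK.
- by move=> i g g'; rewrite ractM enum_rankK.
- by move=> h i g; rewrite !enum_rankK lractA.
Defined.

Lemma skel_ofP H G (X : biset H G) : biso (skel_of X) X.
Proof.
exists (fun i : 'I_#|X| => enum_val i); split.
- by exists enum_rank; [apply: enum_valK | apply: enum_rankK].
- by move=> h i; rewrite /= enum_rankK.
- by move=> i g; rewrite /= enum_rankK.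
Qed.

Inductive burnside_rel H G : seq (int * skel H G) -> seq (int * skel H G) -> Prop :=
| BurnsideIso (s t : skel H G) : biso s t ->
    burnside_rel [:: (1%R, s)] [:: (1%R, t)]
| BurnsideUnion (s t u : skel H G) : biso u (bunion s t) ->
    burnside_rel [:: (1%R, u)] [:: (1%R, s); (1%R, t)].

Definition burnside (H G : finGroupType) : lmodType int := pmod (@burnside_rel H G).

Definition bclass H G (X : biset H G) : burnside H G :=
  pgen (@burnside_rel H G) (skel_of X).

Local Open Scope ring_scope.

Lemma bclass_iso H G (X Y : biset H G) : biso X Y -> bclass X = bclass Y.
Proof.
move=> XY; have r : burnside_rel [:: (1, skel_of X)] [:: (1, skel_of Y)].
  apply: BurnsideIso; apply: biso_trans (skel_ofP X) _.
  by apply: biso_trans XY _; apply/biso_sym/skel_ofP.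
by have := pgen_rel r; rewrite /fsum !big_seq1 /= !scale1r.
Qed.

Lemma bclass_union H G (X Y : biset H G) :
  bclass (bunion X Y) = bclass X + bclass Y.
Proof.
have r : burnside_rel [:: (1, skel_of (bunion X Y))] [:: (1, skel_of X); (1, skel_of Y)].
  apply: BurnsideUnion; apply: biso_trans (skel_ofP _) _.
  by apply: bunion_congr; apply/biso_sym/skel_ofP.
by have := pgen_rel r; rewrite /fsum !big_cons !big_nil /= !scale1r !addr0.
Qed.

Lemma bclass_skel H G (s : skel H G) : bclass s = pgen (@burnside_rel H G) s.
Proof.
have r : burnside_rel [:: (1, skel_of s)] [:: (1, s)].
  by apply: BurnsideIso; apply: skel_ofP.
by have := pgen_rel r; rewrite /fsum !big_seq1 /= !scale1r.
Qed.

Lemma blift_rel H G (V : lmodType int) (f : biset H G -> V) :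
    (forall X Y, biso X Y -> f X = f Y) ->
    (forall X Y, f (bunion X Y) = f X + f Y) ->
  forall s t, burnside_rel s t -> fsum (T := skel H G) f s = fsum (T := skel H G) f t.
Proof.
move=> fI fU _ _ [s t /fI|s t u /fI];
  rewrite /fsum !big_cons !big_nil /= !addr0 !scale1r => -> //.
Qed.

Section BurnsideComp.
Variables K H G : finGroupType.

(* The biadditive map with ([Y], [X]) |-> [Y o X]. *)
Definition burnside_comp (v : burnside K H) (u : burnside H G) : burnside K G :=
  plift (fun t : skel K H => plift (fun s : skel H G => bclass (bcomp t s)) u) v.

Let rel_r (Y : biset K H) :=
  @blift_rel H G _ (fun X => bclass (bcomp Y X))
    (fun X X' XX' => bclass_iso (bcomp_congr (biso_refl Y) XX'))
    (fun X X' => etrans (bclass_iso (bcomp_unionr Y X X')) (bclass_union _ _)).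

Lemma burnside_comp_linear_r v : linear (burnside_comp v).
Proof.
by apply: plift_linear_l => t; apply: plift_linear; apply: rel_r.
Qed.

Let lift_r (Y : biset K H) (u : burnside H G) :=
  plift (R := @burnside_rel H G) (fun s : skel H G => bclass (bcomp Y s)) u.

Let lift_r_linear (Y : biset K H) : linear (lift_r Y).
Proof. by apply: plift_linear; apply: rel_r. Qed.

Let rel_l u : forall s t, burnside_rel s t ->
  fsum (T := skel K H) (lift_r^~ u) s = fsum (T := skel K H) (lift_r^~ u) t.
Proof.
apply: (@blift_rel K H _ (lift_r^~ u)) => [X Y XY|X Y].
  apply: (@plift_ext int _ (@burnside_rel H G)) => s; apply: bclass_iso.
  by apply: bcomp_congr XY (biso_refl _).
rewrite /lift_r /plift /fsum -big_split /=; apply: eq_bigr => p _.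
by rewrite -scalerDr (bclass_iso (bcomp_unionl _ _ _)) bclass_union.
Qed.

Lemma burnside_comp_linear_l u : linear (burnside_comp^~ u).
Proof. by apply: plift_linear; apply: rel_l. Qed.

Lemma burnside_comp_class (Y : biset K H) (X : biset H G) :
  burnside_comp (bclass Y) (bclass X) = bclass (bcomp Y X).
Proof.
rewrite /burnside_comp {1}/bclass plift_gen; last exact: rel_l.
rewrite /bclass plift_gen; last exact: rel_r.
by apply: bclass_iso; apply: bcomp_congr; apply: skel_ofP.
Qed.

End BurnsideComp.

Lemma burnside_ext H G (V : lmodType int) (f g : burnside H G -> V) :
  linear f -> linear g -> (forall X, f (bclass X) = g (bclass X)) -> f =1 g.
Proof. by move=> lf lg fg; apply: pmod_ext => // s; rewrite -bclass_skel. Qed.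

Definition biset_cat : lincat int.
Proof.
apply: (@LinCat int finGroupType (fun G H => burnside H G) (fun G => bclass (breg G))
          (fun G H K v u => burnside_comp v u)).
- by move=> G H K u; apply: burnside_comp_linear_l.
- by move=> G H K v; apply: burnside_comp_linear_r.
- move=> G H; apply: burnside_ext => //; first exact: burnside_comp_linear_r.
  by move=> X; rewrite burnside_comp_class; apply/bclass_iso/bcomp1l.
- move=> G H; apply: burnside_ext => //; first exact: burnside_comp_linear_l.
  by move=> X; rewrite burnside_comp_class; apply/bclass_iso/bcomp1r.
- move=> G H K L w v u; move: u.
  apply: burnside_ext => [a u u'||X]; rewrite ?burnside_comp_linear_r //.
    exact: burnside_comp_linear_r.
  move: v; apply: burnside_ext => [a v v'|a v v'|Y];
    rewrite ?(burnside_comp_linear_l, burnside_comp_linear_r) //.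
  move: w; apply: burnside_ext => [a w w'|a w w'|Z];
    rewrite ?(burnside_comp_linear_l, burnside_comp_linear_r) //.
  by rewrite !burnside_comp_class; apply/bclass_iso/bcompA.
Defined.

End Bisets.

Section Linearization.
Local Open Scope ring_scope.
Variable k : comPzRingType.

Section TensComp.
Variables (U V W : lmodType int) (c : V -> U -> W).
Hypothesis c_l : forall u, linear (c^~ u).
Hypothesis c_r : forall v, linear (c v).

(* The k-bilinear map with (1 (x) v, 1 (x) u) |-> 1 (x) c v u. *)
Definition tens_comp (v : tens k V) (u : tens k U) : tens k W :=
  plift (fun n : V => plift (fun m : U => tgen k (c n m)) u) v.

Let rel_r n := @tlift_rel k U _ (fun m => tgen k (c n m)).

Lemma linear_D (A B : lmodType int) (f : A -> B) :
  linear f -> {morph f : x y / x + y}.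
Proof. by move=> lf x y; rewrite -[x]scale1r lf !scale1r. Qed.

Let tc_r n : {morph (fun m => tgen k (c n m)) : x y / x + y}.
Proof. by move=> x y; rewrite (linear_D (c_r n)) tgenD. Qed.

Lemma tens_comp_linear_r v : linear (tens_comp v).
Proof.
by apply: plift_linear_l => n; apply: plift_linear; apply/tlift_rel/tc_r.
Qed.

Let tc_l u : {morph (fun n => plift (R := @tens_rel k U)
                                (fun m : U => tgen k (c n m)) u) : x y / x + y}.
Proof.
move=> x y; rewrite /plift /fsum -big_split /=; apply: eq_bigr => p _.
by rewrite (linear_D (c_l _)) tgenD scalerDr.
Qed.

Lemma tens_comp_linear_l u : linear (tens_comp^~ u).
Proof. by apply: plift_linear; apply/tlift_rel/tc_l. Qed.

Lemma tens_comp_gen n m : tens_comp (tgen k n) (tgen k m) = tgen k (c n m).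
Proof.
rewrite /tens_comp plift_gen; last exact/tlift_rel/tc_l.
by rewrite plift_gen //; apply/tlift_rel/tc_r.
Qed.

End TensComp.

Definition linearize (C : lincat int) : lincat k.
Proof.
apply: (@LinCat k (Ob C) (fun x y => tens k (homc x y)) (fun x => tgen k (idc x))
          (fun x y z g f => tens_comp (@compc int C x y z) g f)).
- move=> x y z f; by apply: tens_comp_linear_l => ?; apply: compc_linear_l.
- by move=> x y z g; apply: tens_comp_linear_r => ?; apply: compc_linear_r.
- move=> x y; apply: pmod_ext => // [|f].
    by apply: tens_comp_linear_r => ?; apply: compc_linear_r.
  by rewrite tens_comp_gen ?compc1l // => ?; [apply: compc_linear_l | apply: compc_linear_r].
- move=> x y; apply: pmod_ext => // [|f].
    by apply: tens_comp_linear_l => ?; apply: compc_linear_l.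
  by rewrite tens_comp_gen ?compc1r // => ?; [apply: compc_linear_l | apply: compc_linear_r].
- move=> x y z w h g f.
  have L x' y' z' f' := @tens_comp_linear_l _ _ _ (@compc int C x' y' z')
    (fun u => compc_linear_l u) f'.
  have R x' y' z' g' := @tens_comp_linear_r _ _ _ (@compc int C x' y' z')
    (fun v => compc_linear_r v) g'.
  move: f; apply: pmod_ext => [a u u'|a u u'|f]; rewrite ?R //.
  move: g; apply: pmod_ext => [a u u'|a u u'|g]; rewrite ?(L, R) //.
  move: h; apply: pmod_ext => [a u u'|a u u'|h]; rewrite ?(L, R) //.
  rewrite !tens_comp_gen ?compcA // => ?;
    by [apply: compc_linear_l | apply: compc_linear_r].
Defined.

End Linearization.

Section GroupHomomorphisms.
Local Open Scope group_scope.

Section IndRes.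
Variables (G H : finGroupType) (phi : {morphism [set: G] >-> H}).

Let phi1 : phi 1 = 1. Proof. exact: morph1. Qed.
Let phiM x y : phi (x * y) = phi x * phi y. Proof. by apply: morphM; rewrite inE. Qed.

Definition Ind : biset H G.
Proof.
apply: (@Biset H G H (@BisetOn H G H
  (fun h' h => h' * h) (fun h g => h * phi g) _ _ _ _ _)).
- exact: mul1g.
- by move=> h h' x; rewrite mulgA.
- by move=> x; rewrite phi1 mulg1.
- by move=> x g g'; rewrite phiM mulgA.
- by move=> h x g; rewrite mulgA.
Defined.

Definition Res : biset G H.
Proof.
apply: (@Biset G H H (@BisetOn G H H
  (fun g h => phi g * h) (fun h h' => h * h') _ _ _ _ _)).
- by move=> x; rewrite phi1 mul1g.
- by move=> g g' x; rewrite phiM mulgA.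
- exact: mulg1.
- by move=> x h h'; rewrite mulgA.
- by move=> g x h; rewrite mulgA.
Defined.

End IndRes.

Definition fsthom (G H : finGroupType) : {morphism [set: G * H] >-> G} :=
  Morphism (in2W (fun x y => erefl : (x * y).1 = x.1 * y.1)).
Definition sndhom (G H : finGroupType) : {morphism [set: G * H] >-> H} :=
  Morphism (in2W (fun x y => erefl : (x * y).2 = x.2 * y.2)).

Lemma unit_mulA : @associative unit (fun _ _ => tt). Proof. by []. Qed.
Lemma unit_mul1g : @left_id unit unit tt (fun _ _ => tt). Proof. by case. Qed.
Lemma unit_mulVg : @left_inverse unit unit unit tt id (fun _ _ => tt).
Proof. by case. Qed.
HB.instance Definition _ :=
  Finite_isGroup.Build unit unit_mulA unit_mul1g unit_mulVg.

Definition bdiag (G : finGroupType) : biset (G * G)%type unit.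
Proof.
apply: (@Biset (G * G)%type unit G (@BisetOn (G * G)%type unit G
  (fun g x => g.1 * x * g.2^-1) (fun x _ => x) _ _ _ _ _)) => //.
- by move=> x; rewrite /= invg1 mulg1 mul1g.
- by move=> g g' x; rewrite /= invMg !mulgA.
Defined.

Definition bmid (K H G : finGroupType) :
  biset (K * G)%type ((K * H) * (H * G))%type.
Proof.
apply: (@Biset (K * G)%type ((K * H) * (H * G))%type (K * H * G)%type
  (@BisetOn (K * G)%type ((K * H) * (H * G))%type (K * H * G)%type
  (fun a x => (a.1 * x.1.1, x.1.2, a.2 * x.2))
  (fun x b => (x.1.1 * b.1.1, b.1.2^-1 * x.1.2 * b.2.1, x.2 * b.2.2)) _ _ _ _ _)).
- by move=> [[k h] g]; rewrite /= !mul1g.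
- by move=> a a' [[k h] g]; rewrite /= !mulgA.
- by move=> [[k h] g]; rewrite /= invg1 mul1g !mulg1.
- by move=> [[k h] g] b b'; rewrite /= invMg !mulgA.
- by move=> a [[k h] g] b; rewrite /= !mulgA.
Defined.

End GroupHomomorphisms.

Definition subquotient (Q G : finGroupType) : Prop :=
  exists B N : {group G}, (N <| B)%g /\ ([set: Q] \isog B / N)%g.

Record group_class := GroupClass {
  gclass :> finGroupType -> Prop;
  gclass_subquotient : forall Q G, gclass G -> subquotient Q G -> gclass Q;
  gclass_prod : forall G H : finGroupType, gclass G -> gclass H -> gclass (G * H)%type
}.

Lemma gclass_unit (D : group_class) (G : finGroupType) : D G -> D unit.
Proof.
move=> DG; apply: gclass_subquotient DG _.
exists 1%G, 1%G; split; first exact: normal1.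
rewrite quotient1 /=; apply: trivial_isog => //.
by apply/setP => -[]; rewrite !inE.
Qed.

Section BisetIdentities.
Local Open Scope group_scope.

Lemma hom1 (G H : finGroupType) (f : {morphism [set: G] >-> H}) : f 1 = 1.
Proof. exact: morph1. Qed.

Lemma homM (G H : finGroupType) (f : {morphism [set: G] >-> H}) x y :
  f (x * y) = f x * f y.
Proof. by apply: morphM; rewrite inE. Qed.

Lemma homV (G H : finGroupType) (f : {morphism [set: G] >-> H}) x :
  f x^-1 = (f x)^-1.
Proof. by apply: morphV; rewrite inE. Qed.

Lemma Ind_comp (G H K : finGroupType) (f : {morphism [set: G] >-> H})
    (g : {morphism [set: H] >-> K}) (h : {morphism [set: G] >-> K}) :
  (forall x, h x = g (f x)) -> biso (bcomp (Ind g) (Ind f)) (Ind h).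
Proof.
move=> hE; apply: (@bcomp_biso _ _ _ (Ind g) (Ind f) (Ind h) (fun y x => y * g x)).
- by move=> y z x /=; rewrite homM mulgA.
- by move=> k y x /=; rewrite mulgA.
- by move=> y x z /=; rewrite homM hE mulgA.
- by move=> z; exists z, 1; rewrite hom1 mulg1.
- move=> y x y' x' E; exists (x * x'^-1) => /=; split; last by rewrite mulgKV.
  by rewrite homM homV mulgA E mulgK.
Qed.

Lemma Res_comp (G H K : finGroupType) (f : {morphism [set: G] >-> H})
    (g : {morphism [set: H] >-> K}) (h : {morphism [set: G] >-> K}) :
  (forall x, h x = g (f x)) -> biso (bcomp (Res f) (Res g)) (Res h).
Proof.
move=> hE; apply: (@bcomp_biso _ _ _ (Res f) (Res g) (Res h) (fun y x => g y * x)).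
- by move=> y z x /=; rewrite homM mulgA.
- by move=> k y x /=; rewrite homM hE mulgA.
- by move=> y x z /=; rewrite mulgA.
- by move=> z; exists 1, z; rewrite hom1 mul1g.
- move=> y x y' x' E; exists (y^-1 * y') => /=; split; first by rewrite mulKVg.
  by rewrite homM homV -mulgA -E mulKg.
Qed.

Lemma Ind_id (G : finGroupType) (f : {morphism [set: G] >-> G}) :
  (forall x, f x = x) -> biso (Ind f) (breg G).
Proof. by move=> fE; exists id; split=> //= [|x g]; [exists id | rewrite fE]. Qed.

Lemma Res_id (G : finGroupType) (f : {morphism [set: G] >-> G}) :
  (forall x, f x = x) -> biso (Res f) (breg G).
Proof. by move=> fE; exists id; split=> //= [|x g]; [exists id | rewrite fE]. Qed.

(* Mackey formula for a single double coset: P is the fibre product of f and g. *)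
Lemma Res_Ind (G H L P : finGroupType) (f : {morphism [set: G] >-> L})
    (g : {morphism [set: H] >-> L}) (p : {morphism [set: P] >-> G})
    (q : {morphism [set: P] >-> H}) :
    (forall z, f (p z) = g (q z)) ->
    (forall x y, f x = g y -> exists z, p z = x /\ q z = y) ->
    (forall l, exists x y, l = g y * f x) ->
  biso (bcomp (Res g) (Ind f)) (bcomp (Ind q) (Res p)).
Proof.
move=> fg pull cos.
pose Z : biset H G := @Biset H G L (@BisetOn H G L (fun y l => g y * l)
  (fun l x => l * f x)
  (fun l => etrans (congr1 (fun t => t * l) (hom1 g)) (mul1g l))
  (fun y y' l => etrans (congr1 (fun t => t * l) (homM g y y')) (esym (mulgA _ _ _)))
  (fun l => etrans (congr1 (fun t => l * t) (hom1 f)) (mulg1 l))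
  (fun l x x' => etrans (congr1 (fun t => l * t) (homM f x x')) (mulgA _ _ _))
  (fun y l x => mulgA _ _ _)).
apply: (@biso_trans _ _ _ Z); last apply: biso_sym.
  apply: (@bcomp_biso _ _ _ (Res g) (Ind f) Z (fun y x => y * x)) => /=.
  - by move=> y h x; rewrite mulgA.
  - by move=> k y x; rewrite mulgA.
  - by move=> y x h; rewrite mulgA.
  - by move=> z; exists 1, z; rewrite mul1g.
  - move=> y x y' x' E; exists (y^-1 * y'); split; first by rewrite mulKVg.
    by rewrite -mulgA -E mulKg.
apply: (@bcomp_biso _ _ _ (Ind q) (Res p) Z (fun y x => g y * f x)) => /=.
- by move=> y h x; rewrite !homM fg mulgA.
- by move=> k y x; rewrite homM mulgA.
- by move=> y x h; rewrite homM mulgA.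
- by move=> z; have [x [y ->]] := cos z; exists y, x.
- move=> y x y' x' E; have [|z [zx zy]] := pull (x * x'^-1) (y^-1 * y').
    by rewrite !homM !homV; apply: (canLR (mulgK _)); rewrite -mulgA -E mulKg.
  by exists z; rewrite zx zy mulKVg mulgKV.
Qed.

Definition diaghom (G : finGroupType) : {morphism [set: G] >-> (G * G)%type} :=
  Morphism (in2W (fun x y => erefl : (x * y, x * y) = (x, x) * (y, y))).

Definition unithom (G : finGroupType) : {morphism [set: G] >-> unit} :=
  Morphism (in2W (fun x y : G => erefl : tt = tt * tt)).

Lemma bdiag_IndRes (G : finGroupType) :
  biso (bcomp (Ind (diaghom G)) (Res (unithom G))) (bdiag G).
Proof.
apply: (@bcomp_biso _ _ _ (Ind (diaghom G)) (Res (unithom G)) (bdiag G)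
  (fun y x => y.1 * y.2^-1)) => //=.
- by move=> y h x /=; rewrite invMg mulgA mulgK.
- by move=> k y x /=; rewrite invMg !mulgA.
- by move=> z; exists (z, 1), tt; rewrite invg1 mulg1.
- move=> [y1 y2] [] [y1' y2'] [] /= E; exists (y2^-1 * y2'); split=> //.
  by congr (_, _); rewrite /= ?mulgA ?E ?mulgV ?mul1g ?mulgKV.
Qed.

Section Triples.
Variables K H G : finGroupType.
Local Notation T := (K * H * G)%type.

Definition hom12 : {morphism [set: T] >-> (K * H)%type} :=
  Morphism (in2W (fun x y : T => erefl : (x * y).1 = x.1 * y.1)).
Definition hom23 : {morphism [set: T] >-> (H * G)%type} :=
  Morphism (in2W (fun x y : T => erefl :
    ((x * y).1.2, (x * y).2) = (x.1.2, x.2) * (y.1.2, y.2))).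
Definition hom13 : {morphism [set: T] >-> (K * G)%type} :=
  Morphism (in2W (fun x y : T => erefl :
    ((x * y).1.1, (x * y).2) = (x.1.1, x.2) * (y.1.1, y.2))).
Definition hom1223 : {morphism [set: T] >-> ((K * H) * (H * G))%type} :=
  Morphism (in2W (fun x y : T => erefl :
    ((x * y).1, ((x * y).1.2, (x * y).2)) =
    (x.1, (x.1.2, x.2)) * (y.1, (y.1.2, y.2)))).

Lemma bmid_IndRes : biso (bcomp (Ind hom13) (Res hom1223)) (bmid K H G).
Proof.
apply: (@bcomp_biso _ _ _ (Ind hom13) (Res hom1223) (bmid K H G)
  (fun y x => (y.1 * x.1.1, x.1.2^-1 * x.2.1, y.2 * x.2.2))).
- by move=> [a b] [[k h] g] [[x1 x2] [x3 x4]] /=; rewrite invMg -!mulgA mulKg.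
- by move=> [a b] [c d] [[x1 x2] [x3 x4]] /=; rewrite !mulgA.
- move=> [c d] [[x1 x2] [x3 x4]] [[g1 g2] [g3 g4]] /=.
  by rewrite invMg !mulgA.
- by move=> [[k h] g]; exists 1, ((k, 1), (h, g)); rewrite /= invg1 !mul1g.
- move=> [a b] [[x1 x2] [x3 x4]] [a' b'] [[y1 y2] [y3 y4]] /= [E1 E2 E3].
  exists (a^-1 * a', x2 * y2^-1, b^-1 * b'); split.
    by congr (_, _); rewrite /= mulKVg.
  congr (_, _); congr (_, _) => /=.
  + by rewrite -mulgA -E1 mulKg.
  + by rewrite mulgKV.
  + by rewrite -mulgA -E2 mulKVg.
  + by rewrite -mulgA -E3 mulKg.
Qed.

End Triples.

End BisetIdentities.

Section GreenFunctors.
Local Open Scope ring_scope.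
Variable k : comPzRingType.

(* Not algType, which excludes the zero algebra. *)
Record kalgebra (V : lmodType k) := KAlgebra {
  amul : V -> V -> V;
  aone : V;
  amulA : associative amul;
  amul1l : left_id aone amul;
  amul1r : right_id aone amul;
  amul_linear_r : forall x, linear (amul x);
  amul_linear_l : forall y, linear (amul^~ y)
}.

Definition kalgebra_op (V : lmodType k) (a : kalgebra V) : kalgebra V.
Proof.
apply: (@KAlgebra V (fun x y => amul a y x) (aone a)).
- by move=> x y z; rewrite amulA.
- by move=> x; rewrite amul1r.
- by move=> x; rewrite amul1l.
- by move=> x; apply: amul_linear_l.
- by move=> x; apply: amul_linear_r.
Defined.

Definition kalgebra_hom (V W : lmodType k) (a : kalgebra V) (b : kalgebra W)
    (f : V -> W) : Prop :=
  [/\ linear f, {morph f : x y / amul a x y >-> amul b x y} & f (aone a) = aone b].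

Variable D : group_class.

(* homc G H in kD is the tensor product of k with the Burnside group B(H, G). *)
Definition kD : lincat k := linearize k (@fullsub int biset_cat D).

Definition dobj : Type := {G : finGroupType | D G}.
Definition dgrp (G : dobj) : finGroupType := sval G.
Coercion dgrp : dobj >-> finGroupType.

Definition obprod (G H : dobj) : dobj :=
  exist (gclass D) (dgrp G * dgrp H)%type (gclass_prod (svalP G) (svalP H)).

(* The trivial group, which is in D as a subquotient of G. *)
Definition obunit (G : dobj) : dobj := exist (gclass D) unit (gclass_unit (svalP G)).

Definition biset_functor : Type := modfun kD.
Definition bval (A : biset_functor) (G : dobj) : lmodType k := @mob k kD A G.
Coercion bval : biset_functor >-> Funclass.

Definition bact (A : biset_functor) (G H : dobj) (X : biset H G) : A G -> A H :=
  @mmor k kD A G H (tgen k (bclass X)).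
Arguments bact A {G H} X _.

Record green_functor := GreenFunctor {
  gfun :> biset_functor;
  galg : forall G : dobj, kalgebra (gfun G);
  green_res : forall (G H : dobj) (phi : {morphism [set: G] >-> H}),
    kalgebra_hom (galg H) (galg G) (bact gfun (Res phi));
  green_frob_l : forall (G H : dobj) (phi : {morphism [set: G] >-> H})
    (a : gfun H) (b : gfun G),
    amul (galg H) a (bact gfun (Ind phi) b) =
    bact gfun (Ind phi) (amul (galg G) (bact gfun (Res phi) a) b);
  green_frob_r : forall (G H : dobj) (phi : {morphism [set: G] >-> H})
    (a : gfun H) (b : gfun G),
    amul (galg H) (bact gfun (Ind phi) b) a =
    bact gfun (Ind phi) (amul (galg G) b (bact gfun (Res phi) a))
}.

Definition green_op (A : green_functor) : green_functor.
Proof.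
apply: (@GreenFunctor (gfun A) (fun G => kalgebra_op (galg A G))).
- move=> G H phi; have [lin mul one] := green_res A phi.
  by split=> // x y; apply: mul.
- by move=> G H phi a b; apply: green_frob_r.
- by move=> G H phi a b; apply: green_frob_l.
Defined.

Section AssociatedCategory.
Variable A : green_functor.

(* Inflation is restriction along a projection. *)
Definition gtimes (G H : dobj) (a : A G) (b : A H) : A (obprod G H) :=
  amul (galg A (obprod G H))
    (bact A (G := G) (H := obprod G H) (Res (fsthom G H)) a)
    (bact A (G := H) (H := obprod G H) (Res (sndhom G H)) b).

Definition assoc_comp (G H K : dobj) (a : A (obprod K H)) (b : A (obprod H G)) :
  A (obprod K G) :=
  bact A (G := obprod (obprod K H) (obprod H G)) (H := obprod K G) (bmid K H G) (gtimes a b).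

Definition assoc_id (G : dobj) : A (obprod G G) :=
  bact A (G := obunit G) (H := obprod G G) (bdiag G) (aone (galg A (obunit G))).


Section Functoriality.
Variables G H K : dobj.

Lemma bact_linear (X : biset H G) : linear (bact A (G := G) (H := H) X).
Proof. exact: mmor_linear. Qed.

Lemma bact_iso (X Y : biset H G) :
  biso X Y -> bact A (G := G) (H := H) X =1 bact A (G := G) (H := H) Y.
Proof. by move=> XY u; rewrite /bact (bclass_iso XY). Qed.

Lemma bact_reg (u : A G) : bact A (G := G) (H := G) (breg G) u = u.
Proof. exact: (@mmor_id k kD A G u). Qed.

Lemma bact_comp (Y : biset K H) (X : biset H G) (u : A G) :
  bact A (G := G) (H := K) (bcomp Y X) u =
  bact A (G := H) (H := K) Y (bact A (G := G) (H := H) X u).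
Proof.
rewrite /bact -burnside_comp_class.
rewrite -(tens_comp_gen k (c := @burnside_comp K H G)).
- exact: (@mmor_comp k kD A G H K).
- exact: burnside_comp_linear_l.
- exact: burnside_comp_linear_r.
Qed.

End Functoriality.

Definition gind (G H : dobj) (f : {morphism [set: G] >-> H}) : A G -> A H :=
  bact A (G := G) (H := H) (Ind f).
Definition gres (G H : dobj) (f : {morphism [set: G] >-> H}) : A H -> A G :=
  bact A (G := H) (H := G) (Res f).

Lemma gind_linear G H (f : {morphism [set: dgrp G] >-> dgrp H}) : linear (gind f).
Proof. exact: bact_linear. Qed.

Lemma gres_linear G H (f : {morphism [set: dgrp G] >-> dgrp H}) : linear (gres f).
Proof. exact: bact_linear. Qed.

Lemma gind_comp G H K (f : {morphism [set: dgrp G] >-> dgrp H})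
    (g : {morphism [set: dgrp H] >-> dgrp K})
    (h : {morphism [set: dgrp G] >-> dgrp K}) u :
  (forall x, h x = g (f x)) -> gind g (gind f u) = gind h u.
Proof. by move=> hE; rewrite /gind -bact_comp; apply/bact_iso/Ind_comp. Qed.

Lemma gres_comp G H K (f : {morphism [set: dgrp G] >-> dgrp H})
    (g : {morphism [set: dgrp H] >-> dgrp K})
    (h : {morphism [set: dgrp G] >-> dgrp K}) u :
  (forall x, h x = g (f x)) -> gres f (gres g u) = gres h u.
Proof. by move=> hE; rewrite /gres -bact_comp; apply/bact_iso/Res_comp. Qed.

Lemma gind_id G (f : {morphism [set: dgrp G] >-> dgrp G}) u :
  (forall x, f x = x) -> gind f u = u.
Proof. by move=> fE; rewrite -[RHS]bact_reg; apply/bact_iso/Ind_id. Qed.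

Lemma gres_id G (f : {morphism [set: dgrp G] >-> dgrp G}) u :
  (forall x, f x = x) -> gres f u = u.
Proof. by move=> fE; rewrite -[RHS]bact_reg; apply/bact_iso/Res_id. Qed.

Lemma gres_ind G H L P (f : {morphism [set: dgrp G] >-> dgrp L})
    (g : {morphism [set: dgrp H] >-> dgrp L})
    (p : {morphism [set: dgrp P] >-> dgrp G})
    (q : {morphism [set: dgrp P] >-> dgrp H}) u :
    (forall z, f (p z) = g (q z)) ->
    (forall x y, f x = g y -> exists z, p z = x /\ q z = y) ->
    (forall l, exists x y, l = (g y * f x)%g) ->
  gres g (gind f u) = gind q (gres p u).
Proof.
move=> fg pull cos; rewrite /gres /gind -!bact_comp.
by apply: bact_iso; apply: Res_Ind.
Qed.

Local Notation "x ** y" := (amul (galg A _) x y) (at level 40, left associativity).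

Lemma gresM G H (f : {morphism [set: dgrp G] >-> dgrp H}) (x y : A H) :
  gres f (x ** y) = gres f x ** gres f y.
Proof. by have [_ fM _] := green_res A f; apply: fM. Qed.

Lemma gres1 G H (f : {morphism [set: dgrp G] >-> dgrp H}) :
  gres f (aone (galg A H)) = aone (galg A G).
Proof. by have [] := green_res A f. Qed.

Lemma gindMl G H (f : {morphism [set: dgrp G] >-> dgrp H}) (a : A H) (b : A G) :
  a ** gind f b = gind f (gres f a ** b).
Proof. exact: green_frob_l. Qed.

Lemma gindMr G H (f : {morphism [set: dgrp G] >-> dgrp H}) (a : A H) (b : A G) :
  gind f b ** a = gind f (b ** gres f a).
Proof. exact: green_frob_r. Qed.

Lemma assoc_idE G : assoc_id G = gind (H := obprod G G) (diaghom G) (aone (galg A G)).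
Proof.
rewrite /assoc_id -(@bact_iso (obunit G) (obprod G G) _ _ (bdiag_IndRes G)).
rewrite (@bact_comp (obunit G) G (obprod G G)).
congr (bact _ _ _); exact: (@gres1 G (obunit G) (unithom G)).
Qed.

Section PComp.
Variables G H K : dobj.
Local Notation T := (obprod (obprod K H) G).

Lemma assoc_compE (a : A (obprod K H)) (b : A (obprod H G)) :
  assoc_comp a b =
  gind (G := T) (H := obprod K G) (hom13 K H G)
    (gres (G := T) (H := obprod K H) (hom12 K H G) a **
     gres (G := T) (H := obprod H G) (hom23 K H G) b).
Proof.
rewrite /assoc_comp -(@bact_iso (obprod (obprod K H) (obprod H G)) (obprod K G) _ _
  (bmid_IndRes K H G)).
rewrite (@bact_comp (obprod (obprod K H) (obprod H G)) T (obprod K G)).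
congr (bact _ _ _); rewrite -/(gres _ _) /gtimes.
rewrite (@gresM T (obprod (obprod K H) (obprod H G))); congr (_ ** _).
  exact: (@gres_comp T (obprod (obprod K H) (obprod H G)) (obprod K H)).
exact: (@gres_comp T (obprod (obprod K H) (obprod H G)) (obprod H G)).
Qed.

End PComp.

Lemma assoc_comp_linear_l G H K (b : A (obprod H G)) :
  linear (fun a : A (obprod K H) => assoc_comp a b).
Proof.
by move=> c a a'; rewrite !assoc_compE gres_linear amul_linear_l gind_linear.
Qed.

Lemma assoc_comp_linear_r G H K (a : A (obprod K H)) :
  linear (fun b : A (obprod H G) => assoc_comp a b).
Proof.
by move=> c b b'; rewrite !assoc_compE gres_linear amul_linear_r gind_linear.
Qed.

Section PUnits.
Variables G H : dobj.
Variable a : A (obprod H G).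

Lemma passoc1r : assoc_comp a (assoc_id G) = a.
Proof.
pose q : {morphism [set: (dgrp H * dgrp G)%type] >-> (dgrp H * dgrp G * dgrp G)%type} :=
  Morphism (in2W (fun x y => erefl : (x * y, (x * y).2) = (x, x.2) * (y, y.2))%g).
pose T := obprod (obprod H G) G; pose P := obprod H G.
rewrite assoc_compE assoc_idE.
rewrite (@gres_ind G T (obprod G G) P (diaghom G) (hom23 H G G) (sndhom H G) q) //=.
- rewrite (@gres1 P G) (@gindMl P T) (@gres_comp P T _ q _ (idm [set: P])) //.
  rewrite gres_id // amul1r (@gind_comp P T P q _ (idm [set: P])) ?gind_id //.
  by case.
- by move=> x [[h g] g'] /= [-> ->]; exists (h, g').
- move=> [x y]; exists y, ((1, x * y^-1), 1)%g.
  by congr (_, _); rewrite /= ?mulgKV ?mul1g.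
Qed.

Lemma passoc1l : assoc_comp (assoc_id H) a = a.
Proof.
pose q : {morphism [set: (dgrp H * dgrp G)%type] >-> (dgrp H * dgrp H * dgrp G)%type} :=
  Morphism (in2W (fun x y => erefl :
    ((x * y).1, (x * y).1, (x * y).2) = (x.1, x.1, x.2) * (y.1, y.1, y.2))%g).
pose T := obprod (obprod H H) G; pose P := obprod H G.
rewrite assoc_compE assoc_idE.
rewrite (@gres_ind H T (obprod H H) P (diaghom H) (hom12 H H G) (fsthom H G) q) //=.
- rewrite (@gres1 P H) (@gindMr P T) (@gres_comp P T _ q _ (idm [set: P])) //.
    rewrite gres_id // amul1l (@gind_comp P T P q _ (idm [set: P])) ?gind_id //.
    by case.
  by case.
- by move=> x [[h h'] g] /= [-> ->]; exists (h', g).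
- move=> [x y]; exists y, ((x * y^-1, 1), 1)%g.
  by congr (_, _); rewrite /= ?mulgKV ?mul1g.
Qed.

End PUnits.

Section PAssoc.
Variables G H K L : dobj.
Variables (a : A (obprod L K)) (b : A (obprod K H)) (c : A (obprod H G)).

Let P := obprod (obprod (obprod L K) H) G.
Local Notation hom f := (Morphism (in2W (fun x y : dgrp P =>
  erefl : f (x * y)%g = (f x * f y)%g))).

Let pLK : {morphism [set: dgrp P] >-> dgrp (obprod L K)} := hom (fun x => x.1.1).
Let pKH : {morphism [set: dgrp P] >-> dgrp (obprod K H)} :=
  hom (fun x => (x.1.1.2, x.1.2)).
Let pHG : {morphism [set: dgrp P] >-> dgrp (obprod H G)} := hom (fun x => (x.1.2, x.2)).
Let pLG : {morphism [set: dgrp P] >-> dgrp (obprod L G)} :=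
  hom (fun x => (x.1.1.1, x.2)).
Let pLKH : {morphism [set: dgrp P] >-> dgrp (obprod (obprod L K) H)} :=
  hom (fun x => x.1).
Let pLKG : {morphism [set: dgrp P] >-> dgrp (obprod (obprod L K) G)} :=
  hom (fun x => (x.1.1, x.2)).
Let pLHG : {morphism [set: dgrp P] >-> dgrp (obprod (obprod L H) G)} :=
  hom (fun x => (x.1.1.1, x.1.2, x.2)).
Let pKHG : {morphism [set: dgrp P] >-> dgrp (obprod (obprod K H) G)} :=
  hom (fun x => (x.1.1.2, x.1.2, x.2)).

Lemma passocA : assoc_comp a (assoc_comp b c) = assoc_comp (assoc_comp a b) c.
Proof.
transitivity (gind pLG (gres pLK a ** (gres pKH b ** gres pHG c))).
  rewrite !assoc_compE.
  rewrite (@gres_ind (obprod (obprod K H) G) (obprod (obprod L K) G) (obprod K G) P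
             (hom13 K H G) (hom23 L K G) pKHG pLKG) //.
  - rewrite gindMl !gresM (@gres_comp P _ _ pKHG _ pKH) //.
    rewrite (@gres_comp P _ _ pKHG _ pHG) // (@gres_comp P _ _ pLKG _ pLK); last first.
      by case=> [[[]]].
    exact: gind_comp.
  - move=> [[k' h] g] [[l k0] g'] /= [-> ->].
    by exists (l, k0, h, g').
  - move=> [x y]; exists (x, 1, 1)%g, (1, 1, y)%g.
    by congr (_, _); rewrite /= ?mul1g ?mulg1.
rewrite !assoc_compE.
rewrite (@gres_ind (obprod (obprod L K) H) (obprod (obprod L H) G) (obprod L H) P
           (hom13 L K H) (hom12 L H G) pLKH pLHG) //.
- rewrite gindMr !gresM (@gres_comp P _ _ pLKH _ pLK) //.
  rewrite (@gres_comp P _ _ pLKH _ pKH) // (@gres_comp P _ _ pLHG _ pHG) //.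
  by rewrite amulA; apply/esym/gind_comp.
- move=> [[l k0] h] [[l' h'] g] /= [-> ->].
  by exists (l', k0, h', g).
- move=> [x y]; exists (x, 1, y)%g, (1, 1, 1)%g.
  by congr (_, _); rewrite /= ?mul1g ?mulg1.
Qed.

End PAssoc.

Definition assoc_cat : lincat k.
Proof.
apply: (@LinCat k dobj (fun G H => A (obprod H G)) assoc_id
          (fun G H K a b => assoc_comp a b)).
- by move=> G H K b; apply: assoc_comp_linear_l.
- by move=> G H K a; apply: assoc_comp_linear_r.
- by move=> G H a; apply: passoc1l.
- by move=> G H a; apply: passoc1r.
- by move=> G H K L a b c; apply: passocA.
Defined.

End AssociatedCategory.

End GreenFunctors.


Arguments bact {k D} A {G H} X _.
Arguments gtimes {k D} A {G H} a b.
Arguments assoc_comp {k D} A {G H K} a b.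
Arguments assoc_id {k D} A G.
Arguments gind {k D} A {G H} f _.
Arguments gres {k D} A {G H} f _.

(* Main.v *)
Require Import Defs.
From mathcomp Require Import all_boot all_order all_fingroup all_algebra.
From mathcomp Require Import boolp.

(* Restriction along the swap [G * H -> H * G] is the identity on objects and an
   involution on morphisms. It exchanges the two factors of a composite, and the
   opposite multiplication puts them back in order; moving the swap past the
   inductions defining composition and identities is the Mackey formula for a
   pullback square. *)

Set Implicit Arguments.
Unset Strict Implicit.
Unset Printing Implicit Defensive.

(** Sharing the object map [f] keeps [m] and [m'] in one type, so no transport arises; the laws are
    propositions, settled by proof irrelevance. *)
Lemma linfunctor_eq (k : comPzRingType) (C C' : lincat k) (f : Ob C -> Ob C')
    (m m' : forall x y, homc x y -> homc (f x) (f y))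
    (l : forall x y, linear (@m x y)) (l' : forall x y, linear (@m' x y)) i i' c c' :
  (forall x y u, m x y u = m' x y u) ->
  @LinFun k C C' f m l i c = @LinFun k C C' f m' l' i' c'.
Proof.
move=> mm'; have {mm'} E : m = m'.
  by do 2 apply: functional_extensionality_dep => ?; apply: funext => u.
by case: m' / E l' i' c' => *; congr LinFun; apply: Prop_irrelevance.
Qed.

Section SwapMorphism.
Local Open Scope group_scope.

Definition swaphom (G H : finGroupType) :
    {morphism [set: (G * H)%type] >-> (H * G)%type} :=
  Morphism (in2W (fun x y : (G * H)%type =>
    erefl : ((x * y).2, (x * y).1) = (x.2, x.1) * (y.2, y.1))).

(** The lift of the swap to triples: with two maps [hom13] it forms the pullback square used for
    composites. *)
Definition revhom (G H K : finGroupType) :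
    {morphism [set: (G * H * K)%type] >-> (K * H * G)%type} :=
  Morphism (in2W (fun x y : (G * H * K)%type =>
    erefl : ((x * y).2, (x * y).1.2, (x * y).1.1)
            = (x.2, x.1.2, x.1.1) * (y.2, y.1.2, y.1.1))).

End SwapMorphism.

Section SwapRestriction.
Variables (k : comPzRingType) (D : group_class) (A : green_functor k D).

(** Both sides are restriction along the common diagonal [G -> K] of the square. *)
Lemma gres_square (G H H' K : dobj D) (f : {morphism [set: G] >-> H})
    (g : {morphism [set: H] >-> K}) (f' : {morphism [set: G] >-> H'})
    (g' : {morphism [set: H'] >-> K}) (u : A K) :
  (forall x, g (f x) = g' (f' x)) -> gres A f (gres A g u) = gres A f' (gres A g' u).
Proof.
move=> sq.
have hM (x y : G) : g (f (x * y)%g) = (g (f x) * g (f y))%g.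
  by rewrite !morphM ?inE.
rewrite (@gres_comp _ _ A _ _ _ f g (Morphism (in2W hM))) //.
by rewrite (@gres_comp _ _ A _ _ _ f' g' (Morphism (in2W hM))).
Qed.

(** Only the biset action enters, so this map serves [A] and [green_op A] alike. *)
Definition gswap (G H : dobj D) : A (obprod H G) -> A (obprod G H) :=
  @gres k D A (obprod G H) (obprod H G) (swaphom G H).

Lemma gswap_linear G H : linear (@gswap G H).
Proof. exact: gres_linear. Qed.

Lemma gswapK G H (u : A (obprod H G)) : gswap (gswap u) = u.
Proof.
rewrite /gswap (@gres_comp _ _ A _ _ _ _ _ (idm [set: dgrp (obprod H G)])).
  exact: gres_id.
by case.
Qed.

(** The swap fixes the diagonal, which is therefore its own pullback along the swap. *)
Lemma gswap_id (G : dobj D) : gswap (assoc_id A G) = assoc_id A G.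
Proof.
rewrite assoc_idE /gswap.
rewrite (@gres_ind _ _ A G (obprod G G) (obprod G G) G (diaghom G) (swaphom G G)
           (idm [set: dgrp G]) (diaghom G)) //.
- by rewrite gres_id.
- by move=> x [y z] /= [-> ->]; exists y.
(* The swap is surjective, so there is a single double coset. *)
- move=> [x y]; exists 1%g, (y, x).
  by congr (_, _); rewrite /= mulg1.
Qed.

Lemma gswap_comp G H K (a : A (obprod K H)) (b : A (obprod H G)) :
  gswap (assoc_comp (green_op A) a b) = assoc_comp A (gswap b) (gswap a).
Proof.
rewrite !assoc_compE /gswap.
rewrite [LHS](@gres_ind _ _ A (obprod (obprod K H) G) (obprod G K) (obprod K G)
           (obprod (obprod G H) K) (hom13 K H G) (swaphom G K)
           (revhom G H K) (hom13 G H K)) //.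
- congr (gind _ _ _).
  (* By conversion, the product of [green_op A] is that of [A] with its factors exchanged. *)
  rewrite [LHS](@gresM _ _ A (obprod (obprod G H) K) (obprod (obprod K H) G)).
  by congr (amul _ _ _); apply: gres_square.
- by move=> [[x h] y] [z t] /= [-> ->]; exists (z, h, t).
- move=> [x y]; exists 1%g, (y, x).
  by congr (_, _); rewrite /= mulg1.
Qed.

(** Conjugating [gswap_comp] by the involution [gswap] spares a second Mackey argument. *)
Lemma gswap_comp_op G H K (a : A (obprod K H)) (b : A (obprod H G)) :
  gswap (assoc_comp A a b) = assoc_comp (green_op A) (gswap b) (gswap a).
Proof. by rewrite -[RHS]gswapK gswap_comp !gswapK. Qed.

End SwapRestriction.

Theorem proposition3p6 (k : comPzRingType) (D : group_class) (A : green_functor k D) :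
  lincat_iso (assoc_cat (green_op A)) (opcat (assoc_cat A)).
Proof.
pose F : linfunctor (assoc_cat (green_op A)) (opcat (assoc_cat A)) :=
  @LinFun k (assoc_cat (green_op A)) (opcat (assoc_cat A)) id
    (fun G H => @gswap k D A G H) (@gswap_linear k D A) (@gswap_id k D A)
    (fun G H K a b => @gswap_comp k D A G H K a b).
pose F' : linfunctor (opcat (assoc_cat A)) (assoc_cat (green_op A)) :=
  @LinFun k (opcat (assoc_cat A)) (assoc_cat (green_op A)) id
    (fun G H => @gswap k D A H G) (fun G H => @gswap_linear k D A H G)
    (@gswap_id k D A) (fun G H K a b => @gswap_comp_op k D A K H G b a).
(* Both composites are the identity on objects by conversion, as [linfunctor_eq] demands. *)
by exists F, F'; split; apply: linfunctor_eq => G H u; apply: gswapK.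
Qed.
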